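(* Let $\mathcal{K}\subseteq\mathbb{R}^V$ be a convex corner with centroid $c=(c_x)_{x\in V}$, where $|V|=n$, and let $I\subseteq V$ satisfy $\mathbf{1}_I\in\mathcal{K}$. Then $\sum_{x\in I}c_x\ge |I|^2/(2n)$.
   Context: A convex corner is a compact convex $\mathcal{K}\subseteq(\mathbb{R}_{\ge0})^V$ with nonempty interior such that $0\le u\le v\in\mathcal{K}$ (coordinatewise) implies $u\in\mathcal{K}$. $\mathbf{1}_I$ is the indicator vector of $I$. *)

(* Defs.v *)
From HB Require Import structures.
From mathcomp Require Import all_boot all_order all_algebra.
From mathcomp Require Import all_classical all_reals all_analysis.

Set Implicit Arguments.
Unset Strict Implicit.
Unset Printing Implicit Defensive.

Import Order.TTheory GRing.Theory Num.Theory.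
Import numFieldNormedType.Exports.

Local Open Scope classical_set_scope.
Local Open Scope ring_scope.

(* The alias keeps the sigma-finite instance below, which depends on a proof,
   from being keyed on Measure.sort. *)
Definition measure_fun d (T : measurableType d) (R : realType)
  (m : {measure set T -> \bar R}) : set T -> \bar R := m.

Section exists_sigma_finite_measure.
Context d (T : measurableType d) (R : realType).
Variables (m : {measure set T -> \bar R}) (sm : sigma_finite setT m).

HB.instance Definition _ := Measure.on (measure_fun m).
HB.instance Definition _ :=
  Measure_isSigmaFinite.Build _ _ _ (measure_fun m) sm.

Lemma exists_sigma_finite_measure :
  exists mu : {sigma_finite_measure set T -> \bar R},
    m = mu :> (set T -> \bar R).
Proof. by exists (measure_fun m). Qed.

End exists_sigma_finite_measure.

Section lebesgue_tuple.
Context {R : realType}.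
Local Open Scope ereal_scope.

Definition cons_tuple n
    (p : measurableTypeR R * n.-tuple (measurableTypeR R)) :
  n.+1.-tuple (measurableTypeR R) := [tuple of p.1 :: p.2].

(* n-fold product of the one-dimensional Lebesgue measure, carried over to
   n-tuples by prepending one coordinate at a time; the 0-dimensional case is
   the unit mass on the empty tuple. *)
Fixpoint lebesgue_tuple (n : nat) :
    set (n.-tuple (measurableTypeR R)) -> \bar R :=
  match n with
  | 0%N => dirac ([tuple] : 0.-tuple (measurableTypeR R))
  | m.+1 => pushforward (lebesgue_measure \x @lebesgue_tuple m)
              (@cons_tuple m)
  end.

Lemma measurable_cons_tuple n : measurable_fun [set: _] (@cons_tuple n).
Proof. exact: measurable_cons. Qed.

Let uncons n (t : n.+1.-tuple (measurableTypeR R)) :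
    measurableTypeR R * n.-tuple (measurableTypeR R) :=
  (thead t, [tuple of behead t]).

Let measurable_uncons n : measurable_fun [set: _] (@uncons n).
Proof.
apply/measurable_fun_pairP; split.
  exact: (@measurable_tnth _ (measurableTypeR R) n.+1 ord0).
exact: measurable_behead.
Qed.

Let cons_tupleK n : cancel (@cons_tuple n) (@uncons n).
Proof. by case=> a t; congr pair => //; exact/val_inj. Qed.

Let lebesgue_tupleP n :
  exists mu : {sigma_finite_measure set (n.-tuple (measurableTypeR R)) -> \bar R},
    @lebesgue_tuple n = mu.
Proof.
elim: n => [|n [mu muE]] /=.
  by exists (dirac ([tuple] : 0.-tuple (measurableTypeR R))).
rewrite muE.
set P := pushforward _ _.
pose Pm := measure_function_pushforward__canonical__measure_function_Measure
  (lebesgue_measure \x mu) (@measurable_cons_tuple n).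
have sP : sigma_finite setT P.
  have /sigma_finiteP[F [FT ndF Foo]] :=
    sigma_finiteT (@lebesgue_measure R).
  have /sigma_finiteP[G [GT ndG Goo]] := sigma_finiteT mu.
  exists (fun k => @uncons n @^-1` (F k `*` G k)).
    apply/esym; rewrite -subTset => t _.
    have [i _ Fi] : (\bigcup_i F i) (uncons t).1 by rewrite -FT.
    have [j _ Gj] : (\bigcup_i G i) (uncons t).2 by rewrite -GT.
    exists (maxn i j) => //; split.
      by move: Fi; exact/subsetPset/ndF/leq_maxl.
    by move: Gj; exact/subsetPset/ndG/leq_maxr.
  move=> k; have [mF Fk] := Foo k; have [mG Gk] := Goo k; split.
    rewrite -[X in measurable X]setTI; apply: measurable_uncons => //.
    exact: measurableX.
  rewrite /P /pushforward -comp_preimage.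
  rewrite [X in X @^-1` _](_ : _ = id); last first.
    by apply/funext => p /=; rewrite cons_tupleK.
  by rewrite preimage_id product_measure1E// lte_mul_pinfty// ge0_fin_numE.
by have [Q QE] := exists_sigma_finite_measure (m := Pm) sP; exists Q.
Qed.

Let lebesgue_tuple0 n : @lebesgue_tuple n set0 = 0.
Proof. by have [mu ->] := lebesgue_tupleP n; rewrite measure0. Qed.

Let lebesgue_tuple_ge0 n A : 0 <= @lebesgue_tuple n A.
Proof. by have [mu ->] := lebesgue_tupleP n. Qed.

Let lebesgue_tuple_sigma_additive n : semi_sigma_additive (@lebesgue_tuple n).
Proof.
by have [mu ->] := lebesgue_tupleP n; exact: measure_semi_sigma_additive.
Qed.

HB.instance Definition _ n := isMeasure.Build _ _ _ (@lebesgue_tuple n)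
  (@lebesgue_tuple0 n) (@lebesgue_tuple_ge0 n)
  (@lebesgue_tuple_sigma_additive n).

Let lebesgue_tuple_sigma_finite n : sigma_finite setT (@lebesgue_tuple n).
Proof. by have [mu ->] := lebesgue_tupleP n; exact: sigma_finiteT. Qed.

HB.instance Definition _ n := Measure_isSigmaFinite.Build _ _ _
  (@lebesgue_tuple n) (@lebesgue_tuple_sigma_finite n).

Lemma measurable_box_tuple n (A : 'I_n -> set (measurableTypeR R)) :
  (forall i, measurable (A i)) ->
  measurable [set t : n.-tuple (measurableTypeR R) | forall i, A i (tnth t i)].
Proof.
move=> mA.
rewrite [X in measurable X](_ : _ =
    \big[setI/setT]_(i < n) ((fun t => tnth t i) @^-1` A i)).
  apply: bigsetI_measurable => i _; rewrite -[X in measurable X]setTI.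
  exact: measurable_tnth.
by apply/seteqP; split=> t; rewrite -bigcap_seq /= => H i; [move=> _|];
   apply: H; rewrite /= mem_index_enum.
Qed.

Lemma lebesgue_tuple_box n (A : 'I_n -> set (measurableTypeR R)) :
  (forall i, measurable (A i)) ->
  lebesgue_tuple [set t : n.-tuple (measurableTypeR R) |
    forall i, A i (tnth t i)] = \prod_(i < n) lebesgue_measure (A i).
Proof.
elim: n A => [|n IH] A mA /=.
  rewrite big_ord0 diracE mem_set// => -[] //.
rewrite big_ord_recl -IH// /pushforward.
rewrite [X in (_ \x _) X](_ : _ = A ord0 `*`
   [set t : n.-tuple (measurableTypeR R) | forall i, A (lift ord0 i) (tnth t i)]).
  rewrite product_measure1E//.
  exact: (@measurable_box_tuple n (fun i => A (lift ord0 i))).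
apply/seteqP; split => -[a t] /=.
  by move=> H; split => [|i]; [exact: (H ord0)|have := H (lift ord0 i); rewrite tnthS].
move=> [Aa H] i; case: (unliftP ord0 i) => [j ->|->//]; rewrite tnthS; exact: H.
Qed.

End lebesgue_tuple.

(* The space R^V with the product topology, the pointwise vector space structure
   and the product sigma-algebra (for finite V, the Borel one). *)
Definition Rvec (R : realType) (V : finType) : Type := {ptws V -> R}.

HB.instance Definition _ (R : realType) (V : finType) :=
  Pointed.copy (Rvec R V) (V -> R).

HB.instance Definition _ (R : realType) (V : finType) :=
  Uniform.copy (Rvec R V) {ptws V -> R}.

HB.instance Definition _ (R : realType) (V : finType) :=
  GRing.Lmodule.copy (Rvec R V) (V -> R^o).

Definition Rvec_display : measure_display.
Proof. exact: default_measure_display. Qed.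

Section lebesgue_Rvec.
Context {R : realType} {V : finType}.
Local Open Scope ereal_scope.

Definition Rvec_measurable : set (set (Rvec R V)) :=
  <<s \bigcup_x preimage_set_system setT
       (fun u : Rvec R V => u x : measurableTypeR R) measurable >>.

Let Rvec_measurable0 : Rvec_measurable set0.
Proof. exact: sigma_algebra0. Qed.

Let Rvec_measurableC A : Rvec_measurable A -> Rvec_measurable (~` A).
Proof. exact: sigma_algebraC. Qed.

Let Rvec_measurable_bigcup (F : (set (Rvec R V))^nat) :
  (forall i, Rvec_measurable (F i)) -> Rvec_measurable (\bigcup_i F i).
Proof. exact: sigma_algebra_bigcup. Qed.

HB.instance Definition _ := @isMeasurable.Build Rvec_display (Rvec R V)
  Rvec_measurable Rvec_measurable0 Rvec_measurableC Rvec_measurable_bigcup.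

Lemma measurable_coord (x : V) :
  measurable_fun [set: Rvec R V] (fun u => u x : measurableTypeR R).
Proof.
move=> _ A mA; apply: sub_sigma_algebra; exists x => //.
by exists A.
Qed.

(* Any enumeration of V yields the same measure: see lebesgue_Rvec_box. *)
Definition Rvec_of_tuple (t : #|V|.-tuple (measurableTypeR R)) : Rvec R V :=
  fun x => tnth t (enum_rank x).

Lemma measurable_Rvec_of_tuple : measurable_fun [set: _] Rvec_of_tuple.
Proof.
apply: (@measurability _ _ _ _ _ _ (\bigcup_x preimage_set_system setT
       (fun u : Rvec R V => u x : measurableTypeR R) measurable)) => //.
move=> _ [_ [x _ [A mA <-]] <-].
rewrite setTI -comp_preimage; exact: (@measurable_tnth _ _ _ (enum_rank x)).
Qed.

Definition lebesgue_Rvec : set (Rvec R V) -> \bar R :=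
  pushforward (@lebesgue_tuple R #|V|) Rvec_of_tuple.

HB.instance Definition _ := Measure.copy lebesgue_Rvec
  (measure_function_pushforward__canonical__measure_function_Measure
     (@lebesgue_tuple R #|V|) measurable_Rvec_of_tuple).

Lemma lebesgue_Rvec_box (A : V -> set (measurableTypeR R)) :
  (forall x, measurable (A x)) ->
  lebesgue_Rvec [set u | forall x, A x (u x)] =
    \prod_(x in V) lebesgue_measure (A x).
Proof.
move=> mA; rewrite (reindex _ (onW_bij _ (@enum_val_bij V)))/=.
rewrite (eq_bigl xpredT)// -lebesgue_tuple_box//.
rewrite /lebesgue_Rvec /pushforward; congr lebesgue_tuple.
apply/seteqP; split=> t /= H i.
  by have := H (enum_val i); rewrite /Rvec_of_tuple enum_valK.
by have := H (enum_rank i); rewrite enum_rankK.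
Qed.

End lebesgue_Rvec.

Section convex_corner.
Context {R : realType} {V : finType}.

Definition convex_corner (K : set (Rvec R V)) : Prop :=
  [/\ compact K,
      @convex_set R (Rvec R V) K,
      K `<=` [set u | forall x, 0 <= u x],
      K° !=set0 &
      forall u v : Rvec R V,
        (forall x, 0 <= u x <= v x) -> K v -> K u].

Definition centroid (K : set (Rvec R V)) : Rvec R V :=
  fun x => (\int[lebesgue_Rvec]_(u in K) u x) / fine (lebesgue_Rvec K).

Definition indic_vec (I : {set V}) : Rvec R V := fun x => (x \in I)%:R.

End convex_corner.

(* Main.v *)
(** Let [n = #|V|] and [k = #|I|].  If [D] is star-shaped about [w] and [g] is a
    linear form that is nonnegative on [D], comparing [D] with its image under
    the homothety of centre [w] and ratio [1 - t], then letting [t] tend to 0,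
    gives [(n + 1) * int_D g >= g w * vol D].  Cut [K] into the cells on which
    the coordinates indexed by [I] appear in a given decreasing order
    [x_1, ..., x_k].  Since [K] is a convex corner, the part of [K] in such a
    cell is star-shaped about the indicator vector of [{x_1, ..., x_i}] for
    every [i], and the gap [u x_i - u x_(i+1)] (with [u x_(k+1) = 0]) is a
    nonnegative linear form on it taking the value 1 at that vector.  The sum
    of the coordinates in [I] is the sum over [i] of [i] times the [i]-th gap,
    so its mean over [K] is at least [k (k + 1) / (2 (n + 1))], which is at
    least [k ^ 2 / (2 n)] because [k <= n]. *)
Require Import Defs.
From mathcomp Require Import all_boot all_order all_algebra.
From mathcomp Require Import all_classical all_reals all_analysis.
From mathcomp Require Import measurable_realfun.
From mathcomp Require Import ring lra.

Set Implicit Arguments.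
Unset Strict Implicit.
Unset Printing Implicit Defensive.

Import Order.TTheory GRing.Theory Num.Theory.
Import numFieldNormedType.Exports.

Local Open Scope classical_set_scope.
Local Open Scope ring_scope.

(** * Lebesgue measure on the line under affine maps *)

Section lebesgue_measure_affine.
Context {R : realType}.
Implicit Types (a b : R) (A : set R).

Lemma measurable_affine a b :
  measurable_fun [set: measurableTypeR R]
    (fun r => a * r + b : measurableTypeR R).
Proof. by apply: measurable_funD => //; exact: measurable_funM. Qed.

(** By uniqueness of Lebesgue measure: [a] times the pushforward under the affine map gives
    half-open intervals their length. *)
Lemma lebesgue_measure_preimage_affine a b A : 0 < a ->
  measurable (A : set (measurableTypeR R)) ->
  lebesgue_measure ((fun r => a * r + b) @^-1` A) =
  ((a^-1)%:E * lebesgue_measure A)%E.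
Proof.
move=> a0 mA.
have a0' : 0 <= a by exact: ltW.
have E : lebesgue_measure A = mscale (NngNum a0')
    (measure_function_pushforward__canonical__measure_function_Measure
      lebesgue_measure (measurable_affine a b)) A.
  apply: lebesgue_measure_unique => // _ [[c d] _ <-].
  transitivity (a%:E * lebesgue_measure
    ((fun r : measurableTypeR R => (a * r + b)%R : measurableTypeR R) @^-1`
      `]c, d]%classic))%E => //.
  rewrite [X in (_ * lebesgue_measure X)%E](_ : _ =
      `](c - b) / a, (d - b) / a]%classic); last first.
    apply/seteqP; split => r /=; rewrite !in_itv /= ltr_pdivrMr// ler_pdivlMr//;
    by rewrite ltrBlDr lerBrDr mulrC.
  rewrite !lebesgue_measure_itv /= !lte_fin ltr_pM2r ?invr_gt0//.
  rewrite ltrD2r; case: ifPn => cd; last by rewrite mule0.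
  by rewrite -!EFinD -EFinM; congr EFin; field; rewrite gt_eqF.
by rewrite E /mscale /= muleA -EFinM mulVf ?gt_eqF// mul1e.
Qed.

End lebesgue_measure_affine.

(** * Lebesgue measure on [R^V]: uniqueness and affine change of variables *)

Section lebesgue_Rvec_affine.
Context {R : realType} {V : finType}.
Implicit Types (a : R) (b u : Rvec R V).

Lemma measurable_fun_Rvec d (T : measurableType d) (f : T -> Rvec R V) :
  (forall x, measurable_fun setT (fun t => f t x : measurableTypeR R)) ->
  measurable_fun setT f.
Proof.
move=> mf.
apply: (@measurability _ _ _ _ _ _ (\bigcup_x preimage_set_system setT
       (fun u : Rvec R V => u x : measurableTypeR R) measurable)) => //.
move=> _ [_ [x _ [A mA <-]] <-].
by rewrite setTI -comp_preimage; exact: mf.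
Qed.

Lemma measurable_box (A : V -> set (measurableTypeR R)) :
  (forall x, measurable (A x)) ->
  measurable [set u : Rvec R V | forall x, A x (u x)].
Proof.
move=> mA.
rewrite [X in measurable X](_ : _ =
    \big[setI/setT]_(x : V) ((fun u : Rvec R V => u x) @^-1` A x)).
  apply: bigsetI_measurable => x _; rewrite -[X in measurable X]setTI.
  exact: measurable_coord.
by apply/seteqP; split=> t; rewrite -bigcap_seq /= => H i; [move=> _|];
   apply: H; rewrite /= mem_index_enum.
Qed.

Definition Rvec_affine a b u : Rvec R V := fun x => a * u x + b x.

Lemma measurable_Rvec_affine a b :
  measurable_fun setT (Rvec_affine a b).
Proof.
apply: measurable_fun_Rvec => x.
by apply: (measurableT_comp (measurable_affine a (b x))); exact: measurable_coord.
Qed.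

(** Boxes are stable under intersection and generate the sigma-algebra, and the cubes [[-k, k]^V]
    exhaust the space with finite measure. *)
Lemma lebesgue_Rvec_unique
    (mu : {measure set (Rvec R V) -> \bar R}) :
  (forall A : V -> set (measurableTypeR R), (forall x, measurable (A x)) ->
    lebesgue_Rvec [set u | forall x, A x (u x)] =
    mu [set u | forall x, A x (u x)]) ->
  forall A, measurable A -> lebesgue_Rvec A = mu A.
Proof.
move=> H.
pose G := [set B : set (Rvec R V) |
  exists2 A : V -> set (measurableTypeR R), forall x, measurable (A x)
    & B = [set u | forall x, A x (u x)]].
pose g (k : nat) : set (Rvec R V) := [set u | forall x, `[- k%:R, k%:R]%classic (u x)].
apply: (@measure_unique _ _ _ G g).
- apply/seteqP; split.
  + apply: smallest_sub; first exact: smallest_sigma_algebra.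
    move=> _ [x _ [A mA <-]]; apply: sub_sigma_algebra.
    (* A generating cylinder is the box with the full line in every other coordinate. *)
    exists (fun y => if y == x then A else setT); first by move=> y; case: ifP.
    rewrite setTI; apply/seteqP; split => u /=.
      by move=> Au y; case: eqP => // ->.
    by move=> /(_ x); rewrite eqxx.
  + apply: smallest_sub; first exact: sigma_algebra_measurable.
    by move=> _ [A mA ->]; exact: measurable_box.
- move=> _ _ [A mA ->] [B mB ->].
  exists (fun x => A x `&` B x) => [x|]; first exact: measurableI.
  apply/seteqP; split => u /=; first by move=> [Au Bu] x.
  by move=> ABu; split=> x; have [] := ABu x.
- by move=> k; exists (fun=> `[- k%:R, k%:R]%classic).
- rewrite -subTset => u _.
  (* The sum of the absolute values bounds all coordinates at once. *)
  exists (Num.truncn (\sum_x `|u x|)).+1 => // x /=.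
  rewrite in_itv /= -ler_norml; apply/ltW/(le_lt_trans _ (truncnS_gt _)).
  by rewrite (bigD1 x)//= lerDl sumr_ge0.
- by move=> _ [A mA ->]; exact: H.
- move=> k.
  have /= -> := @lebesgue_Rvec_box R V (fun=> `[- k%:R, k%:R]%classic) (fun=> measurable_itv _).
  rewrite (eq_bigr (fun=> (k%:R - - k%:R)%:E)) => [|x _].
    by rewrite prodEFin ltry.
  rewrite lebesgue_measure_itv/= lte_fin; case: ltP => // kk.
  by congr EFin; apply/esym/le_anti; rewrite subr_le0 kk/= opprK addr_ge0.
Qed.

(** Both sides are measures in [A], so boxes suffice, and there each coordinate contributes one
    factor [a]. *)
Lemma lebesgue_Rvec_preimage_affine a b (A : set (Rvec R V)) : 0 < a ->
  measurable A ->
  lebesgue_Rvec A = ((a ^+ #|V|)%:E * lebesgue_Rvec (Rvec_affine a b @^-1` A))%E.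
Proof.
move=> a0 mA.
have an0 : 0 <= a ^+ #|V| by rewrite exprn_ge0// ltW.
transitivity (mscale (NngNum an0)
    (measure_function_pushforward__canonical__measure_function_Measure
      lebesgue_Rvec (measurable_Rvec_affine a b)) A) => //.
apply: lebesgue_Rvec_unique => // B mB.
transitivity ((a ^+ #|V|)%:E * lebesgue_Rvec [set u : Rvec R V |
  forall x, ((fun r => a * r + b x)%R @^-1` B x) (u x)])%E => //.
have mB' x : measurable
    ((fun r => a * r + b x : measurableTypeR R) @^-1` B x : set (measurableTypeR R)).
  by rewrite -[X in measurable X]setTI; exact: measurable_affine.
rewrite lebesgue_Rvec_box//; have /= -> := lebesgue_Rvec_box mB'.
under [in RHS]eq_bigr do rewrite lebesgue_measure_preimage_affine//.
rewrite big_split /= prodEFin prodr_const.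
by rewrite muleA -EFinM -exprMn mulfV ?gt_eqF// expr1n mul1e.
Qed.

Lemma ge0_integral_Rvec_affine a b (D : set (Rvec R V)) (f : Rvec R V -> \bar R) :
  0 < a -> measurable D -> measurable_fun D f -> (forall u, D u -> (0 <= f u)%E) ->
  (\int[lebesgue_Rvec]_(u in D) f u =
   (a ^+ #|V|)%:E *
     \int[lebesgue_Rvec]_(u in Rvec_affine a b @^-1` D) f (Rvec_affine a b u))%E.
Proof.
move=> a0 mD mf f0.
have an0 : 0 <= a ^+ #|V| by rewrite exprn_ge0// ltW.
rewrite (eq_measure_integral (mscale (NngNum an0)
    (measure_function_pushforward__canonical__measure_function_Measure
      lebesgue_Rvec (measurable_Rvec_affine a b)))); last first.
  by move=> A mA _; exact: lebesgue_Rvec_preimage_affine.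
rewrite ge0_integral_mscale//= ge0_integral_pushforward//.
  exact: measurable_Rvec_affine.
by move=> u; rewrite inE; exact: f0.
Qed.

End lebesgue_Rvec_affine.

(** * Integrals of nonnegative affine functions over star-shaped sets *)

Section star_shaped.
Context {R : realType}.

Lemma bernoulli_le (n : nat) (t : R) : 0 <= t <= 1 ->
  1 - n%:R * t <= (1 - t) ^+ n.
Proof.
move=> /andP[t0 t1]; elim: n => [|n IH]; first by rewrite mul0r subr0.
rewrite exprS; apply: (@le_trans _ _ ((1 - t) * (1 - n%:R * t))); last first.
  by rewrite ler_wpM2l// subr_ge0.
rewrite -natr1; have : 0 <= n%:R * t * t by rewrite !mulr_ge0.
by move=> h; nra.
Qed.

(** This is the limit [t -> 0] without derivatives: Bernoulli's inequality linearizes the powers,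
    and a single small [t] refutes the opposite strict inequality. *)
Lemma le_of_homothety_bounds (n : nat) (c G : R) : 0 <= c -> 0 <= G ->
  (forall t, 0 < t < 1 -> (1 - t) ^+ n * ((1 - t) * G + t * c) <= G) ->
  c <= n.+1%:R * G.
Proof.
move=> c0 G0 H; rewrite leNgt; apply/negP => lt_c.
have {}c0 : 0 < c by apply: le_lt_trans lt_c; rewrite mulr_ge0.
pose d := c - n.+1%:R * G.
have d0 : 0 < d by rewrite subr_gt0.
have dc : d <= c by rewrite lerBlDr lerDl mulr_ge0.
have n0 : 0 < n.+1%:R :> R by [].
(* After Bernoulli the hypothesis reads [d <= n * t * c]; this [t] makes the right-hand side at most
   [d / 2]. *)
pose t := d / (2 * n.+1%:R * c).
have t0 : 0 < t by rewrite divr_gt0// !mulr_gt0.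
have tE : t * n.+1%:R * c = d / 2.
  by rewrite /t; field; rewrite !gt_eqF// ltr0n.
have n1 : 1 <= n.+1%:R :> R by rewrite ler1n.
have t1 : t < 1.
  rewrite -(ltr_pM2r (mulr_gt0 n0 c0)) mulrA tE mul1r.
  have : c <= n.+1%:R * c by rewrite ler_peMl// ltW.
  lra.
have {H} := H t; rewrite t0 t1 => /(_ isT) H.
have t01 : 0 <= t <= 1 by rewrite !ltW.
have B1 := bernoulli_le n t01.
have B2 := bernoulli_le n.+1 t01.
have h1 : (1 - n.+1%:R * t) * G <= (1 - t) ^+ n.+1 * G by rewrite ler_wpM2r.
have h2 : (1 - n%:R * t) * (t * c) <= (1 - t) ^+ n * (t * c).
  by rewrite ler_wpM2r// ltW// mulr_gt0.
have h3 : t * ((1 - n%:R * t) * c) <= t * (n.+1%:R * G).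
  move: H; rewrite mulrDr mulrA -exprSr => H; lra.
move: h3; rewrite ler_pM2l// => h3.
have : n%:R * t * c <= d / 2.
  rewrite -tE [_ * n.+1%:R]mulrC ler_wpM2r ?(ltW c0)// ler_wpM2r ?(ltW t0)//.
  by rewrite ler_nat.
rewrite /d in d0 *; lra.
Qed.

Context {V : finType}.

(** [Rvec_affine (1 - t) (t *: w)] is the homothety of centre [w] and ratio [1 - t]. *)
Definition star_shaped (w : Rvec R V) (D : set (Rvec R V)) :=
  forall t u, 0 < t < 1 -> D u -> D (Rvec_affine (1 - t) (t *: w) u).

Lemma star_shaped_integral_ge (D : set (Rvec R V)) (w : Rvec R V)
    (g : Rvec R V -> R) :
  measurable D -> (lebesgue_Rvec D < +oo)%E -> star_shaped w D ->
  measurable_fun setT g ->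
  (forall u, D u -> 0 <= g u) -> 0 <= g w ->
  (forall t u, g (Rvec_affine (1 - t) (t *: w) u) = (1 - t) * g u + t * g w) ->
  ((g w)%:E * lebesgue_Rvec D <=
   #|V|.+1%:R%:E * \int[lebesgue_Rvec]_(u in D) (g u)%:E)%E.
Proof.
move=> mD Doo starD mg g0 gw0 gE.
have mgD : measurable_fun D (EFin \o g).
  by apply/measurable_EFinP; exact: measurable_funS mg.
have I0 : (0 <= \int[lebesgue_Rvec]_(u in D) (g u)%:E)%E.
  by apply: integral_ge0 => u Du; rewrite lee_fin g0.
have [Ioo|] := ltP (\int[lebesgue_Rvec]_(u in D) (g u)%:E)%E +oo%E; last first.
  rewrite leye_eq => /eqP ->; rewrite gt0_muley ?lte_fin//; exact: leey.
have H (t : R) : 0 < t < 1 ->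
    (((1 - t) ^+ #|V|)%:E * ((1 - t)%:E * \int[lebesgue_Rvec]_(u in D) (g u)%:E +
      (t * g w)%:E * lebesgue_Rvec D) <=
     \int[lebesgue_Rvec]_(u in D) (g u)%:E)%E.
  move=> /[dup] t01 /andP[t0 t1].
  have t1' : 0 < 1 - t by rewrite subr_gt0.
  (* The change of variables turns the integral over [D] into one over the preimage of [D], which
     contains [D] by star-shapedness. *)
  rewrite [leRHS](@ge0_integral_Rvec_affine _ _ (1 - t) (t *: w))//.
  rewrite lee_pmul2l// ?lte_fin ?exprn_gt0//.
  have -> : ((1 - t)%:E * \int[lebesgue_Rvec]_(u in D) (g u)%:E +
      (t * g w)%:E * lebesgue_Rvec D =
      \int[lebesgue_Rvec]_(u in D) (g (Rvec_affine (1 - t) (t *: w) u))%:E)%E.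
    under [in RHS]eq_integral do rewrite gE EFinD EFinM.
    rewrite ge0_integralD//=.
    - by rewrite ge0_integralZl// ?lee_fin ?(ltW t1')// integral_cst.
    - by move=> u Du; rewrite -EFinM lee_fin mulr_ge0 ?g0// ltW.
    - by apply/measurable_EFinP; apply: measurable_funM => //; exact: measurable_funS mg.
    - by move=> u Du; rewrite lee_fin mulr_ge0// ltW.
  apply: ge0_subset_integral => //.
  - by rewrite -[X in measurable X]setTI; exact: measurable_Rvec_affine.
  - apply/measurable_EFinP; apply: (measurable_funS measurableT) => //.
    exact: measurableT_comp mg (measurable_Rvec_affine _ _).
  - by move=> u Du; rewrite lee_fin g0.
  - by move=> u Du; exact: starD.
have IE : (\int[lebesgue_Rvec]_(u in D) (g u)%:E)%E \is a fin_num.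
  by rewrite ge0_fin_numE.
have ME : lebesgue_Rvec D \is a fin_num by rewrite ge0_fin_numE.
move: I0 H; rewrite -(fineK IE) -(fineK ME) -!EFinM !lee_fin => I0 H.
apply: le_of_homothety_bounds => //.
  by rewrite mulr_ge0// fine_ge0.
by move=> t t01; rewrite -lee_fin; have := H t t01; rewrite !(EFinM, EFinD) !muleA.
Qed.

End star_shaped.

(** * Cubes, boundedness and measurability of compact sets *)

Section Rvec_topology.
Context {R : realType} {V : finType}.
Implicit Types (u v : Rvec R V) (K : set (Rvec R V)).

Definition cube u (e : R) : set (Rvec R V) :=
  [set v | forall x, ball (u x) e (v x)].

(** The topology is the supremum of those induced by the coordinates, so the filter generated by the
    cubes need only converge coordinatewise. *)
Lemma nbhs_cube u (U : set (Rvec R V)) :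
  nbhs u U -> exists2 e, 0 < e & cube u e `<=` U.
Proof.
pose F := filter_from [set e : R | 0 < e] (cube u).
have FF : Filter F.
  apply: filter_from_filter; first by exists 1; rewrite /= ltr01.
  move=> d e /= d0 e0; exists (Order.min d e) => [|v uv]; first by rewrite /= lt_min d0 e0.
  by split=> x; apply: le_ball (uv x); rewrite ge_min lexx ?orbT.
suff Fu : F --> (u : {ptws V -> R}) by move=> /Fu.
rewrite cvg_sup => x; rewrite cvg_image; last first.
  by rewrite eqEsubset; split=> r // _; exists (cst r).
move=> W /=; rewrite nbhs_simpl -nbhs_ballE => -[e /= e0 We].
exists ((fun v => v x) @^-1` W); last first.
  by rewrite eqEsubset; split => [j [? + <-//]|j Wj]; exists (fun=> j).
by exists e => // v uv; exact/We/uv.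
Qed.

Lemma coord_continuous (x : V) : continuous (fun u : Rvec R V => u x).
Proof. exact: (@proj_continuous V (fun=> R) x). Qed.

Lemma Rvec_hausdorff : hausdorff_space (Rvec R V).
Proof. exact: (@hausdorff_product V (fun=> R) (fun=> @Rhausdorff R)). Qed.

Lemma measurable_cube u e : measurable (cube u e).
Proof.
apply: (@measurable_box _ _ (fun x => ball (u x) e)) => x.
exact: measurable_ball.
Qed.

Lemma lebesgue_Rvec_cube_gt0 u e : 0 < e -> (0 < lebesgue_Rvec (cube u e))%E.
Proof.
move=> e0; have /= -> := @lebesgue_Rvec_box R V (fun x => ball (u x) e)
  (fun x => measurable_ball _ _).
under eq_bigr do rewrite lebesgue_measure_ball ?(ltW e0)//.
by rewrite prodEFin lte_fin prodr_gt0// => x _; rewrite pmulrn_lgt0.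
Qed.

Lemma lebesgue_Rvec_cube_ltoo u e : 0 <= e -> (lebesgue_Rvec (cube u e) < +oo)%E.
Proof.
move=> e0; have /= -> := @lebesgue_Rvec_box R V (fun x => ball (u x) e)
  (fun x => measurable_ball _ _).
under eq_bigr do rewrite lebesgue_measure_ball//.
by rewrite prodEFin ltry.
Qed.

Lemma compact_coord_bounded K : compact K ->
  exists2 M, 0 < M & forall u x, K u -> `|u x| < M.
Proof.
move=> cK.
have /choice[M HM] : forall x, exists M : R, forall u, K u -> `|u x| <= M.
  move=> x.
  have : compact ((fun u : Rvec R V => u x : R^o) @` K).
    apply: continuous_compact => //; apply: continuous_subspaceT.
    exact: coord_continuous.
  move=> /compact_bounded/ex_strict_bound_gt0[M _ HM]; exists M => u Ku.
  by apply/ltW/HM; exists u.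
exists (1 + \sum_x `|M x|); first by rewrite ltr_pwDl// sumr_ge0.
move=> u x /(HM x) /le_lt_trans; apply.
rewrite (bigD1 x)//= addrCA (le_lt_trans (ler_norm _))// ltrDl.
by rewrite ltr_pwDl// sumr_ge0.
Qed.

Lemma compact_cube K : compact K -> exists2 M, 0 < M & K `<=` cube 0 M.
Proof.
move=> /compact_coord_bounded[M M0 HM]; exists M => // u Ku x.
by rewrite /ball /= sub0r normrN HM.
Qed.

Lemma rat_approx u (e : R) : 0 < e ->
  exists c : {ffun V -> rat}, cube (fun x => ratr (c x)) e u.
Proof.
move=> e0.
have /choice[c Hc] : forall x, exists q : rat, ball (ratr q : R) e (u x).
  move=> x; have /rat_in_itvoo[q] : u x - e < u x + e.
    by rewrite ltrD2l gtrN.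
  rewrite in_itv /= => /andP[q1 q2]; exists q.
  by rewrite /ball /= ltr_norml; apply/andP; split; lra.
by exists (finfun c) => x; rewrite /= ffunE.
Qed.

(** Being closed, [K] is the intersection over [m] of the countable unions of the rational cubes of
    radius [1 / (m + 1)] that meet [K]. *)
Lemma compact_measurable_Rvec K : compact K -> measurable K.
Proof.
move=> cK.
have clK : closed K by exact: compact_closed Rvec_hausdorff cK.
pose cu m (c : {ffun V -> rat}) : set (Rvec R V) :=
  cube (fun x => ratr (c x)) m.+1%:R^-1.
have -> : K = \bigcap_(m : nat)
    \bigcup_(c in [set c | cu m c `&` K !=set0]) cu m c.
  apply/seteqP; split=> u.
    move=> Ku m _; have [|c uc] := @rat_approx u m.+1%:R^-1.
      by rewrite invr_gt0.
    by exists c => //; exists u.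
  move=> Hu; apply: clK => U /nbhs_cube[e e0 eU].
  (* With radius below [e / 2], two points of one cube differ by less than [e] in each
     coordinate. *)
  pose m := Num.truncn (2 / e).
  have me : m.+1%:R^-1 < e / 2.
    by rewrite -[e / 2]invrK ltf_pV2 ?posrE ?invr_gt0 ?divr_gt0// invf_div truncnS_gt.
  have [c [v [cv Kv]] cu'] := Hu m I.
  exists v; split => //; apply: eU => x.
  have := cu' x; have := cv x; rewrite /ball /= => h1 h2.
  rewrite (le_lt_trans (ler_distD (ratr (c x)) _ _))//.
  rewrite [`|u x - _|]distrC (splitr e).
  by rewrite ltrD ?(lt_trans h1 me) ?(lt_trans h2 me).
apply: bigcapT_measurable => m.
rewrite bigcup_mkcond; apply: countable_bigcupT_measurable => [|c].
  exact: countableP.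
by case: ifP => // _; exact: measurable_cube.
Qed.
End Rvec_topology.

(** Summation by parts; it expresses a sum of coordinates through the weighted gaps. *)
Lemma sum_mul_succ_diff (R : pzRingType) (a : nat -> R) k :
  \sum_(j < k) j.+1%:R * (a j - a j.+1) = \sum_(j < k) a j - k%:R * a k.
Proof.
elim: k => [|k IH]; first by rewrite !big_ord0 mul0r subr0.
rewrite !big_ord_recr /= IH -natr1 !mulrBr mulrDl !mul1r.
set s := \sum_(_ < _) _; rewrite -!addrA; congr (s + _).
by rewrite !addrA addNr add0r.
Qed.

Lemma nth_sumr (R : pzRingType) (s : seq R) :
  \sum_(j < size s) s`_j = \sum_(x <- s) x.
Proof. by rewrite (big_nth 0) big_mkord. Qed.

(** * Cells on which given coordinates appear in a fixed decreasing order *)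

Section order_cells.
Context {R : realType} {V : finType}.
Implicit Types (u : Rvec R V) (x y : V) (s : seq V) (K : set (Rvec R V)).

(* Ties are broken by the enumeration of V, so that the cells below partition
   the space rather than merely cover it. *)
Definition decr_rel u x y :=
  (u y < u x) || ((u x == u y) && (enum_rank x <= enum_rank y)%N).

Lemma decr_rel_le u x y : decr_rel u x y -> u y <= u x.
Proof. by move=> /orP[/ltW//|/andP[/eqP-> _]]. Qed.

Lemma decr_rel_total u : total (decr_rel u).
Proof.
move=> x y; rewrite /decr_rel [u y == _]eq_sym.
by have [xy|xy|xy] := ltgtP (u x) (u y); rewrite ?orbT//= leq_total.
Qed.

Lemma decr_rel_trans u : transitive (decr_rel u).
Proof.
move=> y x z /orP[xy|/andP[/eqP xy rxy]] /orP[yz|/andP[/eqP yz ryz]].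
- by rewrite /decr_rel (lt_trans yz xy).
- by rewrite /decr_rel -yz xy.
- by rewrite /decr_rel xy yz.
- by rewrite /decr_rel xy yz eqxx (leq_trans rxy ryz) orbT.
Qed.

Lemma decr_rel_anti u : antisymmetric (decr_rel u).
Proof.
move=> x y /andP[/orP[xy|/andP[/eqP xy rxy]] /orP[yx|/andP[/eqP yx ryx]]].
- by have := lt_trans xy yx; rewrite ltxx.
- by move: xy; rewrite yx ltxx.
- by move: yx; rewrite xy ltxx.
- by apply/enum_rank_inj/val_inj/anti_leq; rewrite rxy.
Qed.

Definition order_cell s : set (Rvec R V) := [set u | sorted (decr_rel u) s].

Lemma measurable_order_cell s : measurable (order_cell s).
Proof.
have mr x y : measurable_fun setT (fun u : Rvec R V => decr_rel u x y).
  apply: measurable_or; last apply: measurable_and => //.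
  - by apply: measurable_fun_ltr; exact: measurable_coord.
  - by apply: measurable_fun_eqr; exact: measurable_coord.
have ms : measurable_fun setT (fun u : Rvec R V => sorted (decr_rel u) s).
  case: s => [//|x s] /=; elim: s x => [//|y s IH] x /=; exact: measurable_and.
by have := ms measurableT [set true] I; rewrite setTI; congr measurable.
Qed.

(** With ties broken, [decr_rel u] is antisymmetric, so a sorted list is determined by its elements.
    This makes the cells disjoint. *)
Lemma order_cell_uniq s1 s2 u : perm_eq s1 s2 ->
  order_cell s1 u -> order_cell s2 u -> s1 = s2.
Proof.
move=> p12 h1 h2.
exact: (sorted_eq (@decr_rel_trans u) (@decr_rel_anti u)).
Qed.

Definition prefix_vec s i : Rvec R V := indic_vec [set x in take i s]%SET.

(** Indices start at 0, and the default value 0 past the end of [s] implements the convention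
    [u x_(k+1) = 0]. *)
Definition coord_at s (j : nat) u : R := [seq u x | x <- s]`_j.

Lemma coord_at_affine s j a (b : Rvec R V) u :
  coord_at s j (Rvec_affine a b u) = a * coord_at s j u + coord_at s j b.
Proof.
rewrite /coord_at; case: s => [|x0 s]; first by rewrite !nth_nil mulr0 add0r.
have [js|js] := ltnP j (size (x0 :: s)); first by rewrite !(nth_map x0).
by rewrite !nth_default ?size_map// mulr0 add0r.
Qed.

Lemma coord_atZ s j a u : coord_at s j (a *: u) = a * coord_at s j u.
Proof.
rewrite /coord_at; case: s => [|x0 s]; first by rewrite !nth_nil mulr0.
have [js|js] := ltnP j (size (x0 :: s)); first by rewrite !(nth_map x0).
by rewrite !nth_default ?size_map// mulr0.
Qed.

Lemma coord_at_prefix s i j : uniq s ->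
  coord_at s j (prefix_vec s i) = ((j < i) && (j < size s))%N%:R.
Proof.
rewrite /coord_at; case: s => [_|x0 s us]; first by rewrite nth_nil andbF.
have [js|js] := ltnP j (size (x0 :: s)).
  by rewrite (nth_map x0)// /prefix_vec /indic_vec inE in_take ?mem_nth// index_uniq// andbT.
by rewrite nth_default ?size_map// andbF.
Qed.

Lemma measurable_coord_at s j :
  measurable_fun setT (coord_at s j : Rvec R V -> R).
Proof.
rewrite /coord_at; case: s => [|x0 s].
  under eq_fun do rewrite nth_nil; exact: measurable_cst.
have [js|js] := ltnP j (size (x0 :: s)).
  under eq_fun do rewrite (nth_map x0)//; exact: measurable_coord.
under eq_fun do rewrite nth_default ?size_map//; exact: measurable_cst.
Qed.

(** The prefix vector is nonincreasing along [s], so mixing it in keeps strict inequalities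
    strict. *)
Lemma star_shaped_order_cell s i : uniq s ->
  star_shaped (prefix_vec s i) (order_cell s).
Proof.
case: s => [//|x0 s] us t u /andP[t0 t1] /(sortedP x0) su.
apply/(sortedP x0) => j js; have := su j js.
have t1' : 0 < 1 - t by rewrite subr_gt0.
set x := nth _ _ j; set y := nth _ _ j.+1 => xy.
have wx : prefix_vec (x0 :: s) i x = (j < i)%N%:R.
  by rewrite /prefix_vec /indic_vec inE in_take ?mem_nth ?(ltnW js)// index_uniq// ltnW.
have wy : prefix_vec (x0 :: s) i y = (j.+1 < i)%N%:R.
  by rewrite /prefix_vec /indic_vec inE in_take ?mem_nth// index_uniq.
have wyx : prefix_vec (x0 :: s) i y <= prefix_vec (x0 :: s) i x.
  by rewrite wx wy ler_nat; case: (ltnP j.+1 i) => // /ltnW ->.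
rewrite /decr_rel /Rvec_affine.
have -> : (t *: prefix_vec (x0 :: s) i) x = t * prefix_vec (x0 :: s) i x by [].
have -> : (t *: prefix_vec (x0 :: s) i) y = t * prefix_vec (x0 :: s) i y by [].
case/orP: xy => [xy|/andP[/eqP -> rxy]].
  by rewrite ltr_leD// ?ltr_pM2l// ler_pM2l.
(* A tie of [u] either persists, with the same tie-break, or becomes a strict inequality in the
   right direction. *)
rewrite ltrD2l ltr_pM2l// rxy andbT (inj_eq (addrI _)).
by rewrite (inj_eq (mulfI (lt0r_neq0 t0))) orbC eq_sym -le_eqVlt.
Qed.

End order_cells.

(** * Volume and coordinate integrals of a convex corner, cell by cell *)

Section convex_corner_theory.
Context {R : realType} {V : finType}.
Variables (K : set (Rvec R V)) (I : {set V}).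
Hypotheses (cornerK : convex_corner K) (KI : K (indic_vec I)).
Implicit Types (u : Rvec R V) (s : seq V).

Let mK : measurable K.
Proof. by case: cornerK => cK _ _ _ _; exact: compact_measurable_Rvec. Qed.

Lemma convex_corner_ge0 u x : K u -> 0 <= u x.
Proof. by case: cornerK => _ _ K0 _ _ /K0. Qed.

Lemma convex_corner_lt_pinfty : (lebesgue_Rvec K < +oo)%E.
Proof.
case: cornerK => /compact_cube[M M0 KM] _ _ _ _.
apply: le_lt_trans (lebesgue_Rvec_cube_ltoo 0 (ltW M0)).
by apply: le_measure; rewrite ?inE//; exact: measurable_cube.
Qed.

Lemma convex_corner_gt0 : (0 < lebesgue_Rvec K)%E.
Proof.
case: cornerK => _ _ _ [u /nbhs_cube[e e0 eK]] _.
apply: lt_le_trans (lebesgue_Rvec_cube_gt0 u e0) _.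
by apply: le_measure; rewrite ?inE//; exact: measurable_cube.
Qed.

(** Coordinates are bounded on the compact [K]; finiteness is what lets the extended integrals be
    read as the real ones in [centroid]. *)
Lemma convex_corner_coord_ltoo x :
  (\int[lebesgue_Rvec]_(u in K) (u x)%:E < +oo)%E.
Proof.
case: cornerK => /compact_coord_bounded[M M0 KM] _ _ _ _.
have mx : measurable_fun K (fun u : Rvec R V => (u x)%:E).
  apply/measurable_EFinP; apply: (measurable_funS measurableT) => //.
  exact: measurable_coord.
apply: (@le_lt_trans _ _ (\int[lebesgue_Rvec]_(u in K) M%:E)%E).
  apply: ge0_le_integral => //.
  - by move=> u Ku; rewrite lee_fin convex_corner_ge0.
  - by move=> u Ku; rewrite lee_fin (le_trans (ler_norm _))// ltW// KM.
by rewrite integral_cst// lte_mul_pinfty// ?lee_fin ?ltW// convex_corner_lt_pinfty.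
Qed.

Lemma star_shaped_convex_corner w : K w -> star_shaped w K.
Proof.
move=> Kw t u /andP[t0 t1] Ku.
case: cornerK => _ cK _ _ _.
have := cK w u (Itv01 (ltW t0) (ltW t1)); rewrite !inE => /(_ Kw Ku); congr K.
by apply/funext => x; rewrite /Rvec_affine addrC.
Qed.

(** The prefix vector lies below [indic_vec I] coordinatewise, and [K] is closed downward. *)
Lemma convex_corner_prefix s i : {subset s <= I} -> K (prefix_vec s i).
Proof.
case: cornerK => _ _ _ _ cK sI; apply: cK KI => x.
rewrite /prefix_vec /indic_vec inE ler0n ler_nat.
by case: (boolP (x \in take i s)) => // /mem_take/sI ->.
Qed.

Lemma order_cell_integral_ge s : uniq s -> {subset s <= I} ->
  ((\sum_(j < size s) j.+1%:R)%:E * lebesgue_Rvec (K `&` order_cell s) <=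
   #|V|.+1%:R%:E *
   \int[lebesgue_Rvec]_(u in K `&` order_cell s) (\sum_(x <- s) u x)%:E)%E.
Proof.
move=> us sI.
set D := K `&` order_cell s.
have mD : measurable D by apply: measurableI => //; exact: measurable_order_cell.
pose g j u : R := coord_at s j u - coord_at s j.+1 u.
have mg j : measurable_fun setT (g j).
  by apply: measurable_funB; exact: measurable_coord_at.
have g0 j u : D u -> 0 <= g j u.
  move=> [Ku]; rewrite /order_cell /= /g /coord_at.
  case: s {us sI D mD g mg} => [_|x0 s]; first by rewrite !nth_nil subr0.
  move=> /(sortedP x0) su.
  (* Inner gaps are nonnegative by sortedness; the last gap is the last coordinate itself,
     nonnegative on [K]; later ones vanish. *)
  have [js|js] := ltnP j.+1 (size (x0 :: s)).
    rewrite !(nth_map x0)// ?(ltnW js)// subr_ge0.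
    exact/decr_rel_le/su.
  rewrite [X in _ - X]nth_default ?size_map// subr0.
  have [js'|js'] := ltnP j (size (x0 :: s)); last by rewrite nth_default ?size_map.
  by rewrite (nth_map x0)//; exact: convex_corner_ge0.
have gw (j : 'I_(size s)) : g j (prefix_vec s j.+1) = 1.
  by rewrite /g !coord_at_prefix// ltnS leqnn ltn_ord ltnn subr0.
have gE j t u w : g j (Rvec_affine (1 - t) (t *: w) u) = (1 - t) * g j u + t * g j w.
  by rewrite /g !coord_at_affine !coord_atZ; ring.
have sumE u : \sum_(x <- s) u x = \sum_(j < size s) j.+1%:R * g j u.
  rewrite sum_mul_succ_diff.
  rewrite [X in _ * X]nth_default ?size_map// mulr0 subr0.
  by rewrite -[in RHS](size_map u s) nth_sumr big_map.
under eq_integral do rewrite sumE -sumEFin.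
rewrite ge0_integral_sum//; last 2 first.
- move=> j; apply/measurable_EFinP; apply: measurable_funM => //.
  exact: measurable_funS (mg j).
- by move=> j u Du; rewrite lee_fin mulr_ge0// g0.
rewrite ge0_sume_distrr; last first.
  by move=> j _; apply: integral_ge0 => u Du; rewrite lee_fin mulr_ge0// g0.
rewrite -sumEFin ge0_sume_distrl//; apply: lee_sum => j _.
under eq_integral do rewrite EFinM.
rewrite ge0_integralZl//; last 2 first.
- by apply/measurable_EFinP; exact: measurable_funS (mg j).
- by move=> u Du; rewrite lee_fin g0.
rewrite muleCA lee_pmul2l//.
(* Gap [j] is paired with the prefix of length [j + 1], where it equals 1. *)
have := @star_shaped_integral_ge R V D (prefix_vec s j.+1) (g j).
rewrite gw mul1e; apply => //.
- apply: le_lt_trans convex_corner_lt_pinfty.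
  by apply: le_measure; rewrite ?inE//; exact: subIsetl.
- move=> t u t01 [Ku su]; split; last exact: star_shaped_order_cell.
  by apply: star_shaped_convex_corner => //; exact: convex_corner_prefix.
- exact: g0.
- by move=> t u; rewrite gE gw.
Qed.

Lemma convex_corner_integral_ge :
  ((\sum_(j < #|I|) j.+1%:R)%:E * lebesgue_Rvec K <=
   #|V|.+1%:R%:E *
   \int[lebesgue_Rvec]_(u in K) (\sum_(x <- enum I) u x)%:E)%E.
Proof.
pose F s := K `&` order_cell s.
pose S := permutations (enum I).
have mF s : measurable (F s).
  by apply: measurableI => //; exact: measurable_order_cell.
(* Sorting [enum I] by [decr_rel u] yields the cell of [u]. *)
have KE : K = \big[setU/set0]_(s <- S) F s.
  apply/seteqP; split => u; rewrite -bigcup_seq.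
    move=> Ku; exists (sort (decr_rel u) (enum I)).
      by rewrite /= mem_permutations perm_sort.
    by split => //; exact/sort_sorted/decr_rel_total.
  by move=> [s _ []].
have tF : trivIset [set` S] F.
  apply/trivIsetP => s1 s2 /=; rewrite !mem_permutations => s1I s2I.
  move=> /eqP s12; rewrite -subset0 => u [[_ u1] [_ u2]]; apply: s12.
  apply: order_cell_uniq u1 u2; rewrite (perm_trans s1I)// perm_sym//.
have msum (D : set (Rvec R V)) : measurable_fun D
    (fun u : Rvec R V => (\sum_(x <- enum I) u x)%:E).
  apply/measurable_EFinP; apply: (measurable_funS measurableT) => //.
  by apply: measurable_sum => x; exact: measurable_coord.
(* Reading the left-hand side as the integral of a constant lets both sides split over the cells. *)
rewrite -integral_cst// [in X in (X <= _)%E]KE [in X in (_ <= X)%E]KE.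
rewrite !ge0_integral_bigsetU//; last 4 first.
- exact: permutations_uniq.
- by rewrite -KE => u Ku; rewrite lee_fin sumr_ge0// => x _; exact: convex_corner_ge0.
- exact: permutations_uniq.
- by move=> u _; rewrite lee_fin sumr_ge0.
rewrite ge0_sume_distrr; last first.
  move=> s _; apply: integral_ge0 => u [Ku _].
  by rewrite lee_fin sumr_ge0// => x _; exact: convex_corner_ge0.
rewrite big_seq [leRHS]big_seq; apply: lee_sum => s.
rewrite mem_permutations => sI.
rewrite integral_cst//.
have us : uniq s by rewrite (perm_uniq sI) enum_uniq.
have sizes : size s = #|I| by rewrite (perm_size sI) -cardE.
have subI : {subset s <= I} by move=> x; rewrite (perm_mem sI) mem_enum.
have := order_cell_integral_ge us subI; rewrite sizes => /le_trans; apply.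
by under [in leLHS]eq_integral do rewrite (perm_big _ sI) /=.
Qed.

End convex_corner_theory.

(** * From integrals to the centroid, and the final arithmetic *)

Lemma two_sum_succ (R : pzRingType) (k : nat) :
  2%:R * \sum_(j < k) j.+1%:R = k%:R * k.+1%:R :> R.
Proof.
rewrite -natr_sum -!natrM; congr (_%:R).
elim: k => [|k IH]; first by rewrite big_ord0.
by rewrite big_ord_recr /= mulnDr IH -mulnDl addn2 mulnC.
Qed.

Theorem theorem5p4 (R : realType) (V : finType) (K : set (Rvec R V))
    (I : {set V}) :
  convex_corner K ->
  K (indic_vec I) ->
  \sum_(x in I) centroid K x >= #|I|%:R ^+ 2 / (2%:R * #|V|%:R).
Proof.
move=> cK KI.
have mK : measurable K by case: cK => cK _ _ _ _; exact: compact_measurable_Rvec.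
have Koo := convex_corner_lt_pinfty cK.
have K0 := convex_corner_gt0 cK.
have int_fin x : (\int[lebesgue_Rvec]_(u in K) (u x)%:E)%E \is a fin_num.
  rewrite ge0_fin_numE; first exact: convex_corner_coord_ltoo.
  by apply: integral_ge0 => u Ku; rewrite lee_fin; exact: convex_corner_ge0 Ku.
have := convex_corner_integral_ge cK KI.
under eq_integral do rewrite -sumEFin.
rewrite ge0_integral_sum//; last 2 first.
- move=> x; apply/measurable_EFinP; apply: (measurable_funS measurableT) => //.
  exact: measurable_coord.
- by move=> x u Ku; rewrite lee_fin; exact: convex_corner_ge0 Ku.
have KE : lebesgue_Rvec K \is a fin_num by rewrite ge0_fin_numE.
rewrite -(fineK KE) (eq_bigr _ (fun x _ => esym (fineK (int_fin x)))).
rewrite sumEFin big_enum -!EFinM lee_fin => main.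
have M0 : 0 < fine (lebesgue_Rvec K) by rewrite fine_gt0// K0.
rewrite /centroid -mulr_suml ler_pdivlMr//.
(* For empty [V] the bound is a division by 0, hence 0 by convention. *)
have [V0|V0] := posnP #|V|.
  by rewrite V0 mulr0 invr0 mulr0 mul0r sumr_ge0// => x; rewrite fine_ge0//;
    apply: integral_ge0 => u Ku; rewrite lee_fin; exact: convex_corner_ge0 Ku.
have kn : (#|I| <= #|V|)%N by exact: max_card.
rewrite -(ler_pM2l (_ : 0 < #|V|.+1%:R))//; apply: le_trans main.
rewrite mulrA ler_wpM2r ?(ltW M0)//.
have n0 : 0 < #|V|%:R :> R by rewrite ltr0n.
rewrite mulrA ler_pdivrMr ?mulr_gt0//.
rewrite [leRHS]mulrA [X in _ <= X * _]mulrC two_sum_succ -natrX -!natrM ler_nat.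
(* With [k = #|I|] and [n = #|V|], the claim [(n + 1) * k ^ 2 <= k * (k + 1) * n] reduces to
   [k ^ 2 <= k * n]. *)
have -> : (#|I| * #|I|.+1 * #|V| = #|I| * #|V| + #|V| * #|I| ^ 2)%N.
  by rewrite mulnS mulnDl mulnn [(_ ^ 2 * _)%N]mulnC.
by rewrite mulSn leq_add2r -mulnn leq_mul2l kn orbT.
Qed.
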